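(* The space $M^4$ of $3\times3$ real matrices of rank $1$ on $S^8(\sqrt3)$ is homeomorphic to $S^2\otimes S^2$.
   Context: Real $3\times3$ matrices are identified with points of Euclidean space $\mathbb{R}^9$, and $S^8(\sqrt3)$ is the round sphere of matrices $A$ with $\sum_{i,j}a_{ij}^2=3$. $S^2\otimes S^2$ denotes the quotient of $S^2\times S^2$ by the equivalence relation $(x,y)\sim(-x,-y)$, where $S^2$ is the unit sphere in $\mathbb{R}^3$. *)

(* Defs.v *)
From HB Require Import structures.
From mathcomp Require Import all_boot all_order all_algebra.
From mathcomp Require Import all_classical all_reals all_analysis.

Set Implicit Arguments.
Unset Strict Implicit.
Unset Printing Implicit Defensive.

Import Order.TTheory GRing.Theory Num.Theory.
Import numFieldNormedType.Exports.

Local Open Scope classical_set_scope.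
Local Open Scope ring_scope.
Local Open Scope quotient_scope.

Definition homeomorphic (X Y : topologicalType) : Prop :=
  exists (f : X -> Y) (g : Y -> X),
    [/\ cancel f g, cancel g f, continuous f & continuous g].

(* 'M[R]_3 carries the topology of entrywise convergence, which is the one of
   Euclidean R^9; likewise 'rV[R]_3 is R^3.  The library norm on matrices is
   the sup norm, so the Euclidean spheres are written with sums of squares. *)
Definition S8_sqrt3 (R : realType) : set 'M[R]_3 :=
  [set A | \sum_i \sum_j A i j ^+ 2 = 3].

Definition S2 (R : realType) : set 'rV[R]_3 :=
  [set x | \sum_i x ord0 i ^+ 2 = 1].

Definition M4 (R : realType) : set 'M[R]_3 :=
  [set A | S8_sqrt3 A /\ \rank A = 1%N].

Arguments S8_sqrt3 : clear implicits.
Arguments S2 : clear implicits.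
Arguments M4 : clear implicits.

Lemma S2_opp (R : realType) (x : S2 R) : - val x \in S2 R.
Proof.
case: x => x /= /set_mem Sx; apply/mem_set; rewrite /S2 /= in Sx *.
by rewrite -Sx; apply: eq_bigr => i _; rewrite mxE sqrrN.
Qed.

Definition antipode (R : realType) (x : S2 R) : S2 R :=
  exist _ (- val x) (S2_opp x).

Lemma antipodeK (R : realType) : involutive (@antipode R).
Proof. by move=> x; apply: val_inj; rewrite /= opprK. Qed.

Definition antipodal (R : realType) : rel (S2 R * S2 R) :=
  fun p q => (q == p) || (q == (antipode p.1, antipode p.2)).

Lemma antipodal_refl (R : realType) : reflexive (@antipodal R).
Proof. by move=> p; rewrite /antipodal eqxx. Qed.

Lemma antipodal_sym (R : realType) : symmetric (@antipodal R).
Proof.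
have sub p q : @antipodal R p q -> antipodal q p.
  case/orP=> /eqP ->; first exact: antipodal_refl.
  by rewrite /antipodal /= !antipodeK -surjective_pairing eqxx orbT.
by move=> p q; apply/idP/idP; exact: sub.
Qed.

Lemma antipodal_trans (R : realType) : transitive (@antipodal R).
Proof.
move=> q p r /orP[] /eqP ->; first by [].
case/orP=> /eqP ->; first by rewrite /antipodal eqxx orbT.
by rewrite /= !antipodeK -surjective_pairing antipodal_refl.
Qed.

Canonical antipodal_equiv (R : realType) : equiv_rel (S2 R * S2 R) :=
  EquivRel (@antipodal R) (@antipodal_refl R) (@antipodal_sym R)
    (@antipodal_trans R).

(* The topology on the quotient is final for the projection from S2 * S2,
   where S2 has the subspace topology and S2 * S2 the product topology. *)
Definition S2_tensor_S2 (R : realType) : topologicalType :=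
  @quotient_topology (S2 R * S2 R)%type {eq_quot (@antipodal_equiv R)}.

(* Main.v *)
Require Import Defs.
From mathcomp Require Import all_boot all_order all_algebra.
From mathcomp Require Import all_classical all_reals all_analysis.
Import numFieldNormedType.Exports.

(** A matrix has rank 1 exactly when it is a product [x^T *m y] of a nonzero
    column and a nonzero row, and the sum of its squared entries is then
    |x|^2 |y|^2.  So [outer : (x, y) |-> sqrt 3 x^T y] maps pairs of unit vectors
    to rank 1 matrices on the sphere of radius sqrt 3.  The decomposition is
    unique up to the common sign of x and y ([outer_unit_inj]), hence [outer]
    induces a continuous injection of the antipodal quotient into M4.

    For the inverse, let the column j of A be nonzero, let x be this column
    normalized and written as a row, and y = x A / sqrt 3.  All columns of A are
    multiples of x^T, so x^T x A = A, and (x, y) is a preimage of A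
    ([factorK]).  The map [factor j] so defined is continuous where the column j
    does not vanish ([factor_continuous]).  Different choices of j give antipodal pairs at most,
    so composing with the projection to the quotient yields a well defined map
    which agrees near each A with the projection of a single continuous
    [factor j].  The inverse is thus continuous. *)

Set Implicit Arguments.
Unset Strict Implicit.
Unset Printing Implicit Defensive.

Import Order.TTheory GRing.Theory Num.Theory.

Local Open Scope classical_set_scope.
Local Open Scope ring_scope.
Local Open Scope quotient_scope.

(** * Matrices of rank one *)

Lemma rank_col_row (F : fieldType) m n (x : 'cV[F]_m) (y : 'rV[F]_n) :
  x != 0 -> y != 0 -> \rank (x *m y) = 1%N.
Proof.
move=> x0 y0; apply/eqP; rewrite eqn_leq.
rewrite (leq_trans (mxrankM_maxr _ _) (rank_leq_row _)) /=.
rewrite lt0n mxrank_eq0; apply: contraNneq x0 => xy0.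
have [j yj0] : exists j, y ord0 j != 0.
  apply/existsP; apply: contraNT y0; rewrite negb_exists => /forallP y0.
  by apply/eqP/rowP => j; rewrite mxE; apply/eqP; have := y0 j; rewrite negbK.
apply/eqP/colP => i; rewrite mxE; apply: (mulIf yj0); rewrite mul0r.
by move/matrixP/(_ i j): xy0; rewrite mxE big_ord1 mxE.
Qed.

(** In a rank decomposition [A = u *m v] the column [j] is the multiple
    [v_j u], and [v_j] can be divided out as soon as that column is nonzero. *)
Lemma rank1_colP (F : fieldType) m n (A : 'M[F]_(m, n)) j :
  \rank A = 1%N -> col j A != 0 -> exists w : 'rV_n, A = col j A *m w.
Proof.
move=> rA; have := mulmx_base A; move: (col_base A) (row_base A); rewrite rA.
move=> u v <-; have -> : col j (u *m v) = v ord0 j *: u.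
  by apply/colP => i; rewrite !mxE big_ord1 mulrC.
rewrite scaler_eq0 negb_or => /andP[v0 _]; exists ((v ord0 j)^-1 *: v).
by rewrite -scalemxAl -scalemxAr scalerA divff// scale1r.
Qed.

(** * Unit vectors and their outer products *)

Definition sqnorm (R : realType) n (x : 'rV[R]_n) : R :=
  \sum_i x ord0 i ^+ 2.

Section SquareNorm.
Variables (R : realType) (n : nat).
Implicit Types (x y : 'rV[R]_n) (c : R).

Lemma mulmx_tr_sqnorm x : x *m x^T = (sqnorm x)%:M.
Proof.
apply/matrixP => i j; rewrite !ord1 !mxE mulr1n.
by apply: eq_bigr => k _; rewrite mxE expr2.
Qed.

Lemma sqnormZ c x : sqnorm (c *: x) = c ^+ 2 * sqnorm x.
Proof.
by rewrite /sqnorm mulr_sumr; apply: eq_bigr => i _; rewrite mxE exprMn.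
Qed.

Lemma sqnorm_ge0 x : 0 <= sqnorm x.
Proof. by apply: sumr_ge0 => i _; exact: sqr_ge0. Qed.

Lemma sqnorm_eq0 x : (sqnorm x == 0) = (x == 0).
Proof.
apply/idP/eqP => [|->]; last first.
  by rewrite /sqnorm big1// => i _; rewrite mxE expr0n.
rewrite psumr_eq0 => [/allP x0|i _]; last exact: sqr_ge0.
apply/rowP => i; rewrite mxE; apply/eqP; rewrite -sqrf_eq0.
by apply: x0; rewrite mem_index_enum.
Qed.

Lemma sum_sqr_outer m (x : 'rV[R]_m) y :
  \sum_i \sum_j (x^T *m y) i j ^+ 2 = sqnorm x * sqnorm y.
Proof.
rewrite /sqnorm mulr_suml; apply: eq_bigr => i _; rewrite mulr_sumr.
by apply: eq_bigr => j _; rewrite mxE big_ord1 mxE exprMn.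
Qed.

Definition normalize x : 'rV[R]_n := (Num.sqrt (sqnorm x))^-1 *: x.

Lemma sqnorm_normalize x : x != 0 -> sqnorm (normalize x) = 1.
Proof.
move=> x0; rewrite sqnormZ exprVn sqr_sqrtr ?sqnorm_ge0// mulVf//.
by rewrite sqnorm_eq0.
Qed.

End SquareNorm.

(** With [c] the inner product of [y'] and [y], multiplying the equation by
    [y^T] on the right gives [x = c x'], and multiplying it by [x] on the left
    then gives [y = c y'].  Since both [x] and [x'] are unit vectors, c^2 = 1. *)
Lemma outer_unit_inj (R : realType) m n (x x' : 'rV[R]_m) (y y' : 'rV[R]_n) :
  sqnorm x = 1 -> sqnorm y = 1 -> sqnorm x' = 1 ->
  x^T *m y = x'^T *m y' ->
  (x = x' /\ y = y') \/ (x = - x' /\ y = - y').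
Proof.
move=> x1 y1 x'1 E.
pose c := (y' *m y^T) ord0 ord0.
have xE : x = c *: x'.
  have := congr1 (fun A => A *m y^T) E.
  rewrite -!mulmxA mulmx_tr_sqnorm y1 mulmx1 (mx11_scalar (y' *m _)) mul_mx_scalar.
  by move/(congr1 trmx); rewrite linearZ/= !trmxK.
have yE : y = c *: y'.
  have := congr1 (fun A => x *m A) E.
  rewrite !mulmxA mulmx_tr_sqnorm x1 mul1mx {1}xE -scalemxAl mulmx_tr_sqnorm x'1.
  by rewrite scalemx1 mul_scalar_mx.
have /eqP : c ^+ 2 = 1 by move: x1; rewrite xE sqnormZ x'1 mulr1.
rewrite sqrf_eq1 => /orP[] /eqP c1; rewrite xE yE c1 ?scale1r ?scaleN1r.
  by left.
by right.
Qed.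

(** The matrix [x^T *m x] is the orthogonal projection onto the line of [x^T],
    and this line contains every column of [A]. *)
Lemma rank1_normalizeP (R : realType) m n (A : 'M[R]_(m, n)) j :
  \rank A = 1%N -> col j A != 0 ->
  let x := normalize (col j A)^T in x^T *m (x *m A) = A.
Proof.
move=> rA Aj0 x; have Aj0' : (col j A)^T != 0.
  by rewrite trmx_eq0.
have [w Aw] := rank1_colP rA Aj0.
(* The columns of A are multiples of x^T, being multiples of the column j. *)
have {Aw} [w' ->] : exists w', A = x^T *m w'.
  exists (Num.sqrt (sqnorm (col j A)^T) *: w).
  rewrite /x /normalize [(_ *: _)^T]linearZ /= trmxK -scalemxAl -scalemxAr -Aw scalerA.
  rewrite mulVf ?scale1r// sqrtr_eq0 -ltNge lt_neqAle sqnorm_ge0 andbT.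
  by rewrite eq_sym sqnorm_eq0.
by rewrite (mulmxA x) mulmx_tr_sqnorm sqnorm_normalize// mul1mx.
Qed.

(** * Limits in subspaces and in spaces of matrices *)

Lemma near_eq_continuous (X Y : topologicalType) (f g : X -> Y) (x : X) :
  (\forall t \near x, f t = g t) ->
  {for x, continuous g} -> {for x, continuous f}.
Proof.
move=> fg; rewrite /prop_for /continuous_at (nbhs_singleton fg).
apply: cvg_trans; apply: near_eq_cvg.
by apply: filterS fg => t ->.
Qed.

Lemma cvg_val (X : topologicalType) (A : set X) (a : A) :
  val b @[b --> a] --> val a.
Proof. exact: initial_continuous. Qed.

Lemma cvg_set_type (X : topologicalType) (A : set X) T (F : set_system T)
    (f : T -> A) (a : A) : Filter F ->
  val (f t) @[t --> F] --> val a -> f @ F --> a.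
Proof.
move=> FF fa U [_ [[W oW <-] /= Wa WU]]; apply: filterS WU _.
by apply: fa; exact: open_nbhs_nbhs.
Qed.

Lemma cvg_mx (X : topologicalType) m n T (F : set_system T)
    (f : T -> 'M[X]_(m, n)) (M : 'M[X]_(m, n)) : Filter F ->
  (forall i j, f t i j @[t --> F] --> M i j) -> f @ F --> M.
Proof.
move=> FF fM A [P MP PA]; apply: filterS PA _.
by apply: filter_forall => i; apply: filter_forall => j; exact/fM/MP.
Qed.

Section MatrixLimits.
Variables (R : realType) (T : Type) (F : set_system T).
Context {FF : Filter F}.

Lemma cvg_coord m n (f : T -> 'M[R]_(m, n)) (A : 'M[R]_(m, n)) i j :
  f @ F --> A -> f t i j @[t --> F] --> A i j.
Proof. by move=> fA; exact: (continuous_cvg _ (@coord_continuous R m n i j A) fA). Qed.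

Lemma cvg_mulmx m n p (f : T -> 'M[R]_(m, n)) (g : T -> 'M[R]_(n, p))
    (A : 'M[R]_(m, n)) (B : 'M[R]_(n, p)) :
  f @ F --> A -> g @ F --> B -> f t *m g t @[t --> F] --> A *m B.
Proof.
move=> fA gB; apply: cvg_mx => i j; rewrite mxE; under eq_fun do rewrite mxE.
apply: cvg_big => [|k _]; first exact: add_continuous.
by apply: cvgM; exact: cvg_coord.
Qed.

Lemma cvg_trmx m n (f : T -> 'M[R]_(m, n)) (A : 'M[R]_(m, n)) :
  f @ F --> A -> (f t)^T @[t --> F] --> A^T.
Proof.
move=> fA; apply: cvg_mx => i j; rewrite mxE; under eq_fun do rewrite mxE.
exact: cvg_coord.
Qed.

Lemma cvg_col m n (f : T -> 'M[R]_(m, n)) (A : 'M[R]_(m, n)) j :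
  f @ F --> A -> col j (f t) @[t --> F] --> col j A.
Proof.
move=> fA; apply: cvg_mx => i k; rewrite mxE; under eq_fun do rewrite mxE.
exact: cvg_coord.
Qed.

Lemma cvg_scalemx m n (c : R) (f : T -> 'M[R]_(m, n)) (A : 'M[R]_(m, n)) :
  f @ F --> A -> c *: f t @[t --> F] --> c *: A.
Proof.
move=> fA; apply: cvg_mx => i k; rewrite mxE; under eq_fun do rewrite mxE.
by apply: cvgM; [exact: cvg_cst|exact: cvg_coord].
Qed.

Lemma cvg_normalize n (f : T -> 'rV[R]_n) (x : 'rV[R]_n) :
  x != 0 -> f @ F --> x -> normalize (f t) @[t --> F] --> normalize x.
Proof.
move=> x0 fx; have coord i : f t ord0 i @[t --> F] --> x ord0 i.
  exact: cvg_coord.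
apply: cvg_mx => i j; rewrite mxE; under eq_fun do rewrite mxE.
rewrite (ord1 i); apply: cvgM => //; apply: cvgV.
  by rewrite sqrtr_eq0 -ltNge lt_neqAle sqnorm_ge0 andbT eq_sym sqnorm_eq0.
apply: continuous_cvg; first exact: sqrt_continuous.
apply: cvg_big => [|k _]; first exact: add_continuous.
exact: (continuous_cvg _ (@exprn_continuous R 2 _) (coord k)).
Qed.

End MatrixLimits.

(** * The outer product on pairs of unit vectors and its local inverses *)

Section Homeomorphism.
Variable R : realType.
Implicit Types (p q : S2 R * S2 R) (A : M4 R).

Let s3 : R := Num.sqrt 3.

Let s3_neq0 : s3 != 0.
Proof. by rewrite sqrtr_eq0 -ltNge. Qed.

Lemma sqnorm_S2 (x : S2 R) : sqnorm (val x) = 1.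
Proof. by case: x => x /= /set_mem. Qed.

Lemma S2_neq0 (x : S2 R) : val x != 0.
Proof. by rewrite -sqnorm_eq0 sqnorm_S2 oner_neq0. Qed.

Lemma outer_M4 p : s3 *: ((val p.1)^T *m val p.2) \in M4 R.
Proof.
apply/mem_set; split.
  rewrite /S8_sqrt3/= scalemxAr sum_sqr_outer sqnormZ !sqnorm_S2.
  by rewrite !mulr1 mul1r sqr_sqrtr.
rewrite mxrank_scale_nz// rank_col_row ?S2_neq0//.
by rewrite trmx_eq0 S2_neq0.
Qed.

Definition outer p : M4 R := exist (fun B => B \in M4 R) _ (outer_M4 p).

Lemma outer_eqP p q : outer p = outer q <-> antipodal p q.
Proof.
split=> [/(congr1 val)/=/(scalerI s3_neq0)|/orP[]/eqP ->//].
  move=> E; have := outer_unit_inj (sqnorm_S2 _) (sqnorm_S2 _) (sqnorm_S2 _) E.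
  case: p q {E} => [x y] [x' y'] [|]/= [xx' yy']; apply/orP; [left|right].
    by rewrite (val_inj xx') (val_inj yy').
  by apply/eqP; congr pair; apply: val_inj; rewrite /= ?xx' ?yy' opprK.
by apply: val_inj; rewrite /= [(- _)^T]linearN /= mulNmx mulmxN opprK.
Qed.

Lemma outer_continuous : continuous outer.
Proof.
move=> p; apply: cvg_set_type; apply: cvg_scalemx; apply: cvg_mulmx.
  apply: cvg_trmx; apply: continuous_cvg; last exact: cvg_fst.
  exact: cvg_val.
apply: continuous_cvg; last exact: cvg_snd.
exact: cvg_val.
Qed.

(** Any point of the sphere would do as the value of [to_S2] off the sphere. *)
Lemma pole_S2 : delta_mx ord0 ord0 \in S2 R.
Proof.
apply/mem_set; rewrite /S2/= (bigD1 ord0)//= big1 => [|i /negPf i0].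
  by rewrite mxE eqxx expr1n addr0.
by rewrite mxE i0 andbF expr0n.
Qed.

(** A total map to the sphere, so that [factor j] below is defined on all of M4;
    its values are meaningful only where the column [j] is nonzero. *)
Definition to_S2 (x : 'rV[R]_3) : S2 R :=
  insubd (exist (fun y => y \in S2 R) _ pole_S2 : S2 R) x.

Lemma val_to_S2 x : sqnorm x = 1 -> val (to_S2 x) = x.
Proof. by move=> x1; rewrite insubdK//; exact/mem_set. Qed.

Definition left_dir j (A : 'M[R]_3) := normalize (col j A)^T.

Definition right_dir j (A : 'M[R]_3) := s3^-1 *: (left_dir j A *m A).

Definition factor j A :=
  (to_S2 (left_dir j (val A)), to_S2 (right_dir j (val A))).

Section Factor.
Variables (j : 'I_3) (A : M4 R).
Hypothesis Aj0 : col j (val A) != 0.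

Let ctr0 : (col j (val A))^T != 0.
Proof. by rewrite trmx_eq0. Qed.

Let prodK : (left_dir j (val A))^T *m (left_dir j (val A) *m val A) = val A.
Proof. by have /set_mem[_ rA] := valP A; exact: rank1_normalizeP rA Aj0. Qed.

Lemma sqnorm_left_dir : sqnorm (left_dir j (val A)) = 1.
Proof. exact: sqnorm_normalize. Qed.

Lemma sqnorm_right_dir : sqnorm (right_dir j (val A)) = 1.
Proof.
have /set_mem[+ _] := valP A; rewrite /S8_sqrt3/= -[val A]prodK sum_sqr_outer.
rewrite sqnorm_left_dir mul1r prodK sqnormZ exprVn => ->.
by rewrite sqr_sqrtr// mulVf.
Qed.

Lemma factorK : outer (factor j A) = A.
Proof.
apply: val_inj; rewrite /= !val_to_S2 ?sqnorm_left_dir ?sqnorm_right_dir//.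
by rewrite /right_dir -scalemxAr scalerA divff// scale1r prodK.
Qed.

End Factor.

Lemma near_col_neq0 j A : col j (val A) != 0 ->
  \forall B \near A, col j (val B) != 0.
Proof.
move=> Aj0; have Aj : col j (val B) @[B --> A] --> col j (val A).
  exact: cvg_col (@cvg_val _ _ A).
exact: cvgr_neq0 Aj Aj0.
Qed.

(** The junk values of [to_S2] do no harm: they are taken only where the column
    [j] vanishes, hence not near [A]. *)
Lemma factor_continuous j A : col j (val A) != 0 ->
  {for A, continuous (factor j)}.
Proof.
move=> Aj0; have val_cvg : val B @[B --> A] --> val A.
  exact: cvg_val.
have left_cvg : left_dir j (val B) @[B --> A] --> left_dir j (val A).
  by apply: (cvg_normalize _ (cvg_trmx (cvg_col val_cvg))); rewrite trmx_eq0.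
have to_S2_cvg (f : 'M[R]_3 -> 'rV[R]_3) :
    (forall B : M4 R, col j (val B) != 0 -> sqnorm (f (val B)) = 1) ->
    f (val B) @[B --> A] --> f (val A) ->
    to_S2 (f (val B)) @[B --> A] --> to_S2 (f (val A)).
  move=> f1 fA.
  have /near_eq_continuous val_eq : \forall B \near A,
      val (to_S2 (f (val B))) = f (val B).
    by apply: filterS (near_col_neq0 Aj0) => B Bj0; rewrite val_to_S2 ?f1.
  exact: cvg_set_type (val_eq fA).
have left_S2 := to_S2_cvg _ (@sqnorm_left_dir j) left_cvg.
have right_cvg : right_dir j (val B) @[B --> A] --> right_dir j (val A).
  exact: cvg_scalemx (cvg_mulmx left_cvg val_cvg).
have right_S2 := to_S2_cvg _ (@sqnorm_right_dir j) right_cvg.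
exact: cvg_pair left_S2 right_S2.
Qed.

Lemma M4_col_neq0 A : exists j, col j (val A) != 0.
Proof.
apply/existsP; have /set_mem[_] := valP A; apply: contra_eqT.
rewrite negb_exists => /forallP A0; suff -> : val A = 0 by rewrite mxrank0.
apply/matrixP => i j; have /negPn/eqP/colP/(_ i) := A0 j.
by rewrite !mxE.
Qed.

End Homeomorphism.

Theorem mainTheorem3 (R : realType) : homeomorphic (M4 R) (S2_tensor_S2 R).
Proof.
pose Q := quotient_topology {eq_quot (@antipodal_equiv R)}.
pose col_of (A : M4 R) : 'I_3 := xchoose (M4_col_neq0 A).
have col_ofP (A : M4 R) : col (col_of A) (val A) != 0.
  exact: xchooseP (M4_col_neq0 A).
have piP (p q : S2 R * S2 R) : \pi_Q p = \pi_Q q <-> outer p = outer q.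
  by rewrite outer_eqP; split=> /eqmodP.
exists (fun A => \pi_Q (factor (col_of A) A)), (fun q => outer (repr (q : Q))).
split.
- by move=> A; rewrite -[RHS](factorK (col_ofP A)); apply/piP; rewrite reprK.
- by move=> q; rewrite -[RHS](@reprK _ Q); apply/piP; rewrite factorK.
- move=> A; pose j := col_of A.
  (* [col_of] may jump near A, but there the column j is still nonzero, and the
     class of [factor j B] does not depend on the column in use. *)
  apply: (near_eq_continuous (g := \pi_Q \o factor j)).
    apply: filterS (near_col_neq0 (col_ofP A)) => B Bj0.
    by apply/piP; rewrite !factorK.
  apply: continuous_comp; first exact: (factor_continuous (col_ofP A)).
  exact: pi_continuous.
- apply: repr_comp_continuous; first exact: outer_continuous.
  by move=> p q /eqP /piP ->.
Qed.
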